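(* Let $L$ be a complete lattice and let $\mathcal{M}(L)$ be the set of all meet-preserving maps $L\to L$, with the pointwise order. Then $(\mathcal{M}(L),\circ)$ is a co-quantale, where $\circ$ is the usual composition of maps.
   Context: A map between complete lattices is meet-preserving if it preserves arbitrary infima (including the empty one). A co-quantale is a complete lattice $Q$ with an associative binary operation $\ast$ such that $a\ast(\bigwedge_{i\in I}b_i)=\bigwedge_{i\in I}(a\ast b_i)$ and $(\bigwedge_{i\in I}b_i)\ast a=\bigwedge_{i\in I}(b_i\ast a)$ for all $a\in Q$ and all families $\{b_i\}_{i\in I}\subseteq Q$ (including the empty family). *)

(* Defs.v *)
From HB Require Import structures.
From mathcomp Require Import all_boot all_order.
From mathcomp Require Import boolp classical_sets.

Set Implicit Arguments.
Unset Strict Implicit.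
Unset Printing Implicit Defensive.

Import Order.TTheory.
Import FunOrder.Exports.

Local Open Scope classical_set_scope.
Local Open Scope order_scope.

(* [infimums A m] (resp. [supremums A m]) states that [m] is the greatest lower
   (resp. least upper) bound of [A]. The set [A] may be empty, so a complete
   lattice has a top and a bottom. *)
Definition complete_lattice d (L : porderType d) : Prop :=
  forall A : set L, infimums A !=set0 /\ supremums A !=set0.

Definition meet_preserving d d' (L : porderType d) (M : porderType d')
    (f : L -> M) : Prop :=
  forall (A : set L) (m : L), infimums A m -> infimums (f @` A) (f m).

(* Infima are unique, so over a complete lattice the two distributivity clauses
   say that a * (inf b_i) = inf (a * b_i) and (inf b_i) * a = inf (b_i * a).
   The index type [I] may be empty. *)
Definition coquantale d (Q : porderType d) (op : Q -> Q -> Q) : Prop :=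
  [/\ complete_lattice Q,
      associative op,
      forall (a : Q) (I : Type) (b : I -> Q) (m : Q),
        infimums (range b) m -> infimums (range (fun i => op a (b i))) (op a m)
    & forall (a : Q) (I : Type) (b : I -> Q) (m : Q),
        infimums (range b) m -> infimums (range (fun i => op (b i) a)) (op m a)].

Record mpmap d (L : porderType d) := MPMap {
  mpmap_fun :> L -> L;
  mpmap_subproof : `[< meet_preserving mpmap_fun >] }.

(* The order is the one induced by the pointwise order on [L -> L]. *)
HB.instance Definition _ d (L : porderType d) :=
  [isSub for @mpmap_fun d L].
HB.instance Definition _ d (L : porderType d) := [Choice of mpmap L by <:].
HB.instance Definition _ d (L : porderType d) :=
  [SubChoice_isSubPOrder of mpmap L by <: with FunOrder.fun_display].

Lemma le_mpmapP d (L : porderType d) (f g : mpmap L) :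
  f <= g <-> forall x, f x <= g x.
Proof. by split=> [/asboolP|?]; last exact/asboolP. Qed.

Fact mpmap_comp_subproof d (L : porderType d) (f g : mpmap L) :
  `[< meet_preserving (f \o g) >].
Proof.
apply/asboolP => A m Am; rewrite -image_comp.
exact: (asboolW (mpmap_subproof f)) (asboolW (mpmap_subproof g) _ _ Am).
Qed.

Definition mpmap_comp d (L : porderType d) (f g : mpmap L) : mpmap L :=
  MPMap (mpmap_comp_subproof f g).

(* Main.v *)
(* Infima in [mpmap L] are pointwise: a pointwise infimum of meet-preserving
   maps is meet-preserving because infima commute with infima. Distributivity on
   the left is then meet preservation of the outer map, and distributivity on
   the right is evaluation at [a x]. *)
Require Import Defs.
From mathcomp Require Import all_boot all_order.
From mathcomp Require Import boolp classical_sets.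

Set Implicit Arguments.
Unset Strict Implicit.
Unset Printing Implicit Defensive.

Import Order.TTheory.

Local Open Scope classical_set_scope.
Local Open Scope order_scope.

(** The least upper bound of [A] is the infimum of its set of upper bounds. *)
Lemma complete_lattice_infimums d (T : porderType d) :
  (forall A : set T, infimums A !=set0) -> complete_lattice T.
Proof.
move=> infT A; split=> //; have [m [mlb mglb]] := infT (ubound A).
by exists m; split=> [x Ax|y Ay]; [apply: mglb => y; exact | exact: mlb].
Qed.

Lemma mpmap_infimums d (L : porderType d) (f : mpmap L) :
  meet_preserving f.
Proof. exact: asboolW (mpmap_subproof f). Qed.

Lemma mpmap_infimums_of_pointwise d (L : porderType d) (S : set (mpmap L))
    (g : mpmap L) :
  (forall x, infimums [set f x | f in S] (g x)) -> infimums S g.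
Proof.
move=> gP; split=> [f Sf|h hlb]; apply/le_mpmapP => x.
  by apply: (gP x).1; exists f.
by apply: (gP x).2 => _ [f Sf <-]; move: x; apply/le_mpmapP; exact: hlb.
Qed.

(** Here [g] is a bare map, so that the result can supply the proof field when the infimum is built
    as an [mpmap]. *)
Lemma meet_preserving_pointwise_infimums d (L : porderType d)
    (S : set (mpmap L)) (g : L -> L) :
  (forall x, infimums [set f x | f in S] (g x)) -> meet_preserving g.
Proof.
move=> gP A m Am; split=> [_ [a Aa <-]|y ylb].
  apply: (gP a).2 => _ [f Sf <-]; apply: (@le_trans _ _ (f m)).
    by apply: (gP m).1; exists f.
  by apply: (mpmap_infimums f Am).1; exists a.
(* A lower bound [y] of all [g a] lies below every [f a], hence below every [f m], hence below
   [g m]. *)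
apply: (gP m).2 => _ [f Sf <-]; apply: (mpmap_infimums f Am).2 => _ [a Aa <-].
apply: (@le_trans _ _ (g a)); first by apply: ylb; exists a.
by apply: (gP a).1; exists f.
Qed.

Lemma mpmap_pointwise_infimums_ex d (L : porderType d) (S : set (mpmap L)) :
  complete_lattice L ->
  exists g : mpmap L, forall x, infimums [set f x | f in S] (g x).
Proof.
move=> cL; have /choice[g gP] x := (cL [set f x | f in S]).1.
by exists (MPMap (asboolT (meet_preserving_pointwise_infimums gP))).
Qed.

(** Completeness yields a pointwise infimum [h] of [S]; it is also an infimum in [mpmap L], so
    antisymmetry forces [g = h]. *)
Lemma mpmap_infimums_pointwise d (L : porderType d) (S : set (mpmap L))
    (g : mpmap L) :
  complete_lattice L ->
  infimums S g -> forall x, infimums [set f x | f in S] (g x).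
Proof.
move=> cL [glb gglb]; have [h hP] := mpmap_pointwise_infimums_ex S cL.
have [hlb hglb] := mpmap_infimums_of_pointwise hP.
suff -> : g = h by [].
by apply/le_anti; rewrite hglb ?gglb.
Qed.

Theorem proposition4p2 (d : Order.disp_t) (L : porderType d) :
  complete_lattice L -> coquantale (@mpmap_comp d L).
Proof.
move=> cL; split.
- apply: complete_lattice_infimums => S.
  have [g gP] := mpmap_pointwise_infimums_ex S cL.
  by exists g; exact: mpmap_infimums_of_pointwise.
(* The underlying maps are convertible, and the proof field is a Boolean equation, hence
   irrelevant. *)
- by move=> f g h; exact: val_inj.
- move=> a I b m /(mpmap_infimums_pointwise cL) mP.
  apply: mpmap_infimums_of_pointwise => x.
  (* Merging the iterated images turns both sets into the range of [a (b i x)] over [I]. *)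
  by have := mpmap_infimums a (mP x); rewrite !image_comp.
- move=> a I b m /(mpmap_infimums_pointwise cL) mP.
  apply: mpmap_infimums_of_pointwise => x.
  by have := mP (a x); rewrite !image_comp.
Qed.
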